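(* Let $g$ be a left-invariant Riemannian metric on $\tilde E(2)$, the universal covering group of the group of rigid motions of the Euclidean plane. Then $(\tilde E(2),g)$ has non-trivial (i.e. nonzero) index of symmetry if and only if $g$ is flat.
   Context: Let $M$ be a homogeneous Riemannian manifold with Levi-Civita connection $\nabla$. For $p\in M$ put $$\mathfrak s_p=\{v\in T_pM:\ \text{there is a Killing field } X \text{ on } M \text{ with } X(p)=v \text{ and } (\nabla X)_p=0\}.$$ The index of symmetry $i_{\mathfrak s}(M)$ is $\dim \mathfrak s_p$, which by homogeneity does not depend on $p$. The group $\tilde E(2)$ is presented as $\mathbb R^3$ with the multiplication $$(x,y,z)(x',y',z')=(x+x'\cos z-y'\sin z,\ y+x'\sin z+y'\cos z,\ z+z').$$ *)

(* Defs.v *)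
From HB Require Import structures.
From mathcomp Require Import all_boot all_order all_algebra.
From mathcomp Require Import all_classical all_reals all_analysis.

Set Implicit Arguments.
Unset Strict Implicit.
Unset Printing Implicit Defensive.

Import Order.TTheory GRing.Theory Num.Theory.
Import numFieldNormedType.Exports.

Local Open Scope classical_set_scope.
Local Open Scope ring_scope.

(* Riemannian geometry of R^n in its global chart: points, and tangent vectors
   at any point, are row vectors; a metric is given by its Gram matrices in the
   coordinate frame. *)

Definition partial (R : realType) (n : nat) (i : 'I_n)
    (f : 'rV[R]_n -> R) (p : 'rV[R]_n) : R :=
  'D_(delta_mx 0 i : 'rV[R]_n) f p.

Fixpoint Ck (R : realType) (n k : nat) (f : 'rV[R]_n -> R) : Prop :=
  continuous f /\
  match k with
  | 0 => True
  | k'.+1 => forall i : 'I_n,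
      (forall p : 'rV[R]_n, derivable f p (delta_mx 0 i : 'rV[R]_n)) /\
      Ck k' (partial i f)
  end.

Definition smooth (R : realType) (n : nat) (f : 'rV[R]_n -> R) : Prop :=
  forall k : nat, Ck k f.

Definition smooth_field (R : realType) (n : nat)
    (X : 'rV[R]_n -> 'rV[R]_n) : Prop :=
  forall k : 'I_n, smooth (fun p => X p 0 k).

Definition inner (R : realType) (n : nat) (g : 'rV[R]_n -> 'M[R]_n)
    (p u v : 'rV[R]_n) : R :=
  (u *m g p *m v^T) 0 0.

Definition riemannian_metric (R : realType) (n : nat)
    (g : 'rV[R]_n -> 'M[R]_n) : Prop :=
  [/\ forall i j : 'I_n, smooth (fun p => g p i j),
      forall p u v : 'rV[R]_n, inner g p u v = inner g p v u
    & forall p u : 'rV[R]_n, u != 0 -> 0 < inner g p u u].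

(* [christoffel g k i j p] is Gamma^k_ij at p, for the Levi-Civita
   connection. *)
Definition christoffel (R : realType) (n : nat) (g : 'rV[R]_n -> 'M[R]_n)
    (k i j : 'I_n) (p : 'rV[R]_n) : R :=
  2^-1 * \sum_(l < n) invmx (g p) k l *
    (partial i (fun q => g q j l) p + partial j (fun q => g q i l) p
     - partial l (fun q => g q i j) p).

(* Row i of [nabla g X p] is the vector (nabla_{d/dx_i} X)_p. *)
Definition nabla (R : realType) (n : nat) (g : 'rV[R]_n -> 'M[R]_n)
    (X : 'rV[R]_n -> 'rV[R]_n) (p : 'rV[R]_n) : 'M[R]_n :=
  \matrix_(i < n, k < n)
    (partial i (fun q => X q 0 k) p
     + \sum_(j < n) christoffel g k i j p * X p 0 j).

(* The component along d/dx_l of R(d/dx_i, d/dx_j) d/dx_k, where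
   R(X, Y) = [nabla_X, nabla_Y] - nabla_[X, Y]. *)
Definition curvature (R : realType) (n : nat) (g : 'rV[R]_n -> 'M[R]_n)
    (l i j k : 'I_n) (p : 'rV[R]_n) : R :=
  partial i (christoffel g l j k) p - partial j (christoffel g l i k) p
  + \sum_(m < n) (christoffel g m j k p * christoffel g l i m p
                  - christoffel g m i k p * christoffel g l j m p).

Definition flat (R : realType) (n : nat) (g : 'rV[R]_n -> 'M[R]_n) : Prop :=
  forall (l i j k : 'I_n) (p : 'rV[R]_n), curvature g l i j k p = 0.

(* Gram matrix of the Lie derivative of g along X. *)
Definition lie_metric (R : realType) (n : nat) (g : 'rV[R]_n -> 'M[R]_n)
    (X : 'rV[R]_n -> 'rV[R]_n) (p : 'rV[R]_n) : 'M[R]_n :=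
  \matrix_(i < n, j < n) \sum_(k < n)
    (X p 0 k * partial k (fun q => g q i j) p
     + g p k j * partial i (fun q => X q 0 k) p
     + g p i k * partial j (fun q => X q 0 k) p).

Definition killing (R : realType) (n : nat) (g : 'rV[R]_n -> 'M[R]_n)
    (X : 'rV[R]_n -> 'rV[R]_n) : Prop :=
  smooth_field X /\ forall p : 'rV[R]_n, lie_metric g X p = 0.

Definition sym_space (R : realType) (n : nat) (g : 'rV[R]_n -> 'M[R]_n)
    (p : 'rV[R]_n) : set 'rV[R]_n :=
  [set v | exists X : 'rV[R]_n -> 'rV[R]_n,
     [/\ killing g X, X p = v & nabla g X p = 0]].

(* The dimension of a linear subspace of R^n given as a set: the largest size
   of a linearly independent family of its elements. *)
Definition set_dim (R : realType) (n : nat) (S : set 'rV[R]_n) : nat :=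
  \max_(k < n.+1 | `[< exists t : k.-tuple 'rV[R]_n,
                         free t /\ [set` t] `<=` S >]) k.

Definition index_of_symmetry (R : realType) (n : nat)
    (g : 'rV[R]_n -> 'M[R]_n) (p : 'rV[R]_n) : nat :=
  set_dim (sym_space g p).

Definition vec3 (R : realType) (x y z : R) : 'rV[R]_3 :=
  \row_(i < 3) [:: x; y; z]`_i.

Definition E2_mul (R : realType) (a b : 'rV[R]_3) : 'rV[R]_3 :=
  let x := a 0 0 in let y := a 0 1 in let z := a 0 2 in
  let x' := b 0 0 in let y' := b 0 1 in let z' := b 0 2 in
  vec3 (x + x' * cos z - y' * sin z) (y + x' * sin z + y' * cos z) (z + z').

Definition left_invariant (R : realType) (g : 'rV[R]_3 -> 'M[R]_3) : Prop :=
  forall a p u v : 'rV[R]_3,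
    inner g (E2_mul a p) ('d (E2_mul a) p u) ('d (E2_mul a) p v)
    = inner g p u v.

(* Main.v *)
Require Import Defs.
From mathcomp Require Import all_boot all_order all_algebra.
From mathcomp Require Import all_classical all_reals all_analysis.
From mathcomp Require Import ring lra.

(** By left invariance the Gram matrix of g depends on z only: its horizontal
    block is P(z) = m + (rotation by 2z of a traceless symmetric matrix of norm
    r), with r^2 = n^2 + b^2.  The horizontal planes z = const are flat, so the
    Gauss equation makes their sectional curvature in the ambient space a
    nonzero multiple of r^2; hence flatness forces r = 0.  Conversely, if r = 0
    the only possibly nonzero Christoffel symbols are Gamma^k_zz, so g is flat
    and d/dx is a parallel Killing field.

    If r <> 0, shear the coordinates so that g = P(z) (+) f0 dz^2.  For a
    Killing field with horizontal part Y and vertical part W, the equations say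
    that W does not depend on z, that P d_z Y = - f0 grad W, and that the
    symmetric part of (DY) P is - W P' / 2.  Since P has period pi, comparing
    heights z and z + pi kills the Hessian of W; letting z vary then gives
    DY = W J with J the rotation generator, which forces W to be constant.
    Vanishing of the covariant derivative at p now gives W = 0 and P' Y = 0
    there, and P' is invertible. *)

Set Implicit Arguments.
Unset Strict Implicit.
Unset Printing Implicit Defensive.

Import Order.TTheory GRing.Theory Num.Theory.
Import numFieldNormedType.Exports.

Local Open Scope classical_set_scope.
Local Open Scope ring_scope.

(** * Calculus in several variables *)

Lemma is_derive_line (R : realType) (n : nat) (f : 'rV[R]_n -> R)
    (p v : 'rV[R]_n) (s : R) :
  derivable f (s *: v + p) v ->
  is_derive s 1 (fun t : R => f (t *: v + p)) ('D_v f (s *: v + p)).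
Proof.
have E : (fun h : R => h^-1 *:
    (((fun t : R => f (t *: v + p)) \o shift s) (h *: 1) - f (s *: v + p)))
  = (fun h : R => h^-1 *: ((f \o shift (s *: v + p)) (h *: v) - f (s *: v + p))).
  apply/funext => h /=; congr (_ *: (f _ - _)).
  by rewrite [h *: 1]mulr1 scalerDl addrA.
move=> df; apply: DeriveDef.
  by rewrite /derivable E.
by rewrite /derive E.
Qed.

(** The segment is parametrised by [[0, 1]] rather than by its length, so a negative or zero [d]
    needs no separate case. *)
Lemma coordinate_segment_MVT (R : realType) (n : nat) (f : 'rV[R]_n -> R)
    (k : 'I_n) (p : 'rV[R]_n) (d : R) :
  (forall q, derivable f q (delta_mx 0 k : 'rV[R]_n)) ->
  exists2 s, s \in `[0, 1] &
    f (p + d *: delta_mx 0 k) - f p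
    = partial k f (p + (s * d) *: delta_mx 0 k) * d.
Proof.
move=> df; pose e : 'rV[R]_n := delta_mx 0 k.
have dh (s : R) : is_derive s 1 (fun s : R => f ((s * d) *: e + p))
    (partial k f ((s * d) *: e + p) * d).
  apply: (@is_derive1_comp _ (fun t => f (t *: e + p)) (fun s => s * d)).
    exact: is_derive_line.
  rewrite (_ : (fun s0 : R => s0 * d) = d \*: id); last first.
    by apply/funext => x /=; rewrite mulrC.
  by apply: is_derive_eq; rewrite /GRing.scale /= mulr1.
have := @MVT_segment R _ _ 0 1 ler01 (fun x _ => dh x).
case=> [|s s01].
  apply: derivable_within_continuous => x _; case: (dh x) => + _; exact.
rewrite mul1r mul0r scale0r add0r subr0 mulr1 => E.
by exists s => //; rewrite ![p + _]addrC.
Qed.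

(* The points [xi k] lie on the path from [p] to [q] that changes the
   coordinates one after the other. *)
Lemma partial_MVT (R : realType) (n : nat) (f : 'rV[R]_n -> R)
    (p q : 'rV[R]_n) :
  (forall k q, derivable f q (delta_mx 0 k : 'rV[R]_n)) ->
  exists2 xi : 'I_n -> 'rV[R]_n,
    forall k i, `|xi k 0 i - p 0 i| <= `|q 0 i - p 0 i| &
    f q - f p = \sum_(k < n) partial k f (xi k) * (q 0 k - p 0 k).
Proof.
move=> df; pose m (k : nat) : 'rV[R]_n :=
  \row_j (if (j < k)%N then q 0 j else p 0 j).
have mS (k : 'I_n) : m k.+1 = m k + (q 0 k - p 0 k) *: delta_mx 0 k.
  apply/rowP => j; rewrite !mxE eqxx ltnS leq_eqVlt /=.
  have [->|jk] := eqVneq j k; first by rewrite eqxx ltnn /= mulr1 subrKC.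
  rewrite mulr0 addr0.
  by have -> : (j == k :> nat) = false by apply/eqP => /val_inj /eqP; apply/negP.
have step (k : 'I_n) : exists x : 'rV[R]_n,
    (forall i, `|x 0 i - p 0 i| <= `|q 0 i - p 0 i|) /\
    f (m k.+1) - f (m k) = partial k f x * (q 0 k - p 0 k).
  have [s /andP[s0 s1] E] := coordinate_segment_MVT (m k) (q 0 k - p 0 k) (df k).
  exists (m k + (s * (q 0 k - p 0 k)) *: delta_mx 0 k); split; last by rewrite mS.
  move=> i; rewrite !mxE eqxx /=.
  have [->|ik] := eqVneq i k.
    rewrite ltnn mulr1 addrAC subrr add0r normrM ger0_norm //.
    exact: ler_piMl.
  rewrite mulr0 addr0; case: ifP => // _; by rewrite subrr normr0.
have [xi xiP] := choice step.
exists xi; first by move=> k; exact: (xiP k).1.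
rewrite -(eq_bigr _ (fun k _ => (xiP k).2)).
have m0 : m 0%N = p by apply/rowP => j; rewrite mxE.
have mn : m n = q by apply/rowP => j; rewrite mxE ltn_ord.
rewrite -[in LHS]mn -[in LHS]m0.
by rewrite -(telescope_sumr (fun k => f (m k))) // big_mkord.
Qed.

Lemma cvg_rV (R : realType) (n : nat) (T : Type) (F : set_system T)
    {FF : Filter F} (u : T -> 'rV[R]_n) (p : 'rV[R]_n) :
  (forall i, u t 0 i @[t --> F] --> p 0 i) -> u t @[t --> F] --> p.
Proof.
move=> up A [P pP PA]; apply: (@filterS _ F _ [set t | forall i, P 0 i (u t 0 i)]).
  by move=> t ut; apply: PA => i j; rewrite ord1; exact: ut.
by apply: filter_forall => i; exact: up (pP 0 i).
Qed.

(** The chain rule follows from continuity of the partial derivatives, in Carathéodory's form: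
    dividing the increment of [partial_MVT] by [t - t0] leaves a slope function built from the
    slopes [h k] of the coordinates. *)
Lemma is_derive_curve (R : realType) (n : nat) (f : 'rV[R]_n -> R)
    (c : R -> 'rV[R]_n) (v : 'rV[R]_n) (t0 : R) :
  (forall k q, derivable f q (delta_mx 0 k : 'rV[R]_n)) ->
  (forall k, continuous (partial k f)) ->
  (forall k, is_derive t0 1 (fun t => c t 0 k) (v 0 k)) ->
  is_derive t0 1 (f \o c) (\sum_(k < n) partial k f (c t0) * v 0 k).
Proof.
move=> df cf dc.
have [xi xiP] := choice (fun t => let: ex_intro2 x h1 h2 :=
  partial_MVT (c t0) (c t) df in ex_intro _ x (conj h1 h2)).
have /choice[h hP] k := (is_derive1_caratheodory _ _ _).1 (dc k).
have cc k : c t 0 k @[t --> t0] --> c t0 0 k.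
  by apply/differentiable_continuous/derivable1_diffP; by case: (dc k).
(* At [t0] both endpoints are [c t0], so the bound on [xi] pins it down; the same bound makes
   [xi t k] tend to [c t0]. *)
have xi0 k : xi t0 k = c t0.
  apply/rowP => i; apply/eqP; rewrite -subr_eq0 -normr_le0.
  by rewrite (le_trans ((xiP t0).1 k i)) // subrr normr0.
apply/is_derive1_caratheodory.
exists (fun t => \sum_k partial k f (xi t k) * h k t); split.
- move=> t /=; rewrite (xiP t).2 mulr_suml; apply: eq_bigr => k _.
  by have [-> _ _] := hP k; rewrite mulrA.
- apply: cvg_big => [|k _]; first exact: add_continuous.
  apply: cvgM; last by case: (hP k).
  apply: continuous_cvg; first exact: cf.
  rewrite (xi0 k); apply: cvg_rV => i.
  apply/cvgrPdist_le => e e0.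
  apply: filterS ((cvgrPdist_le _ _).1 (cc i) _ e0) => t /= le_e.
  by rewrite distrC (le_trans ((xiP t).1 k i)) // distrC.
- by apply: eq_bigr => k _; have [_ _ ->] := hP k; rewrite xi0.
Qed.

(** * The Killing equations for a rotating metric *)

(** [rotx] and [roty] are the real and imaginary parts of (u + iv) exp(iz). *)
Definition rotx (R : realType) (u v z : R) : R := u * cos z - v * sin z.
Definition roty (R : realType) (u v z : R) : R := u * sin z + v * cos z.

Lemma is_derive_uniq (R : realType) (f : R -> R) (x a b : R) :
  is_derive x 1 f a -> is_derive x 1 f b -> a = b.
Proof. by move=> [_ <-] [_ <-]. Qed.

Lemma is_derive_rotx (R : realType) (u v z : R) :
  is_derive z 1 (rotx u v) (- roty u v z).
Proof.
rewrite -[rotx u v]/(u \*: cos - v \*: sin).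
by apply: is_derive_eq; rewrite /roty /GRing.scale /=; ring.
Qed.

Lemma is_derive_roty (R : realType) (u v z : R) :
  is_derive z 1 (roty u v) (rotx u v z).
Proof.
rewrite -[roty u v]/(u \*: sin + v \*: cos).
by apply: is_derive_eq; rewrite /rotx /GRing.scale /=; ring.
Qed.

Lemma is_derive_lin (R : realType) (F A B : R -> R) (c1 c2 x f a b : R) :
  is_derive x 1 F f -> is_derive x 1 A a -> is_derive x 1 B b ->
  is_derive x 1 (fun t => F t + (c1 * A t + c2 * B t)) (f + (c1 * a + c2 * b)).
Proof.
move=> dF dA dB.
exact: (is_deriveD dF (is_deriveD (is_deriveZ c1 dA) (is_deriveZ c2 dB))).
Qed.

Lemma is_derive_double (R : realType) (h : R -> R) (z d : R) :
  is_derive (z + z) 1 h d -> is_derive z 1 (fun t => h (t + t)) (2 * d).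
Proof.
move=> dh; rewrite [2 * d]mulrC.
exact: (@is_derive1_comp _ h (fun t => t + t)).
Qed.

Lemma rotxDpi2 (R : realType) (u v z : R) : rotx u v (z + pi / 2) = - roty u v z.
Proof. by rewrite /rotx /roty cosDpihalf sinDpihalf; ring. Qed.

Lemma rotyDpi2 (R : realType) (u v z : R) : roty u v (z + pi / 2) = rotx u v z.
Proof. by rewrite /rotx /roty cosDpihalf sinDpihalf; ring. Qed.

(** Doubling turns the shift by pi into a full turn, taken here as four quarter turns. *)
Lemma roty_double_pi (R : realType) (u v z : R) :
  roty u v ((z + pi) + (z + pi)) = roty u v (z + z).
Proof.
have -> : (z + pi) + (z + pi) = (z + z) + pi / 2 + pi / 2 + pi / 2 + pi / 2.
  by field.
by rewrite !(rotxDpi2, rotyDpi2) opprK.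
Qed.

Lemma rotx_double_pi (R : realType) (u v z : R) :
  rotx u v ((z + pi) + (z + pi)) = rotx u v (z + z).
Proof.
have -> : (z + pi) + (z + pi) = (z + z) + pi / 2 + pi / 2 + pi / 2 + pi / 2.
  by field.
by rewrite !(rotxDpi2, rotyDpi2) opprK.
Qed.

Lemma double_angle_coef_eq0 (R : realType) (m n b u v : R) :
  m != 0 -> n ^+ 2 + b ^+ 2 != 0 ->
  (forall z, (m + rotx n b (z + z)) * u + roty n b (z + z) * v = 0) ->
  u = 0 /\ v = 0.
Proof.
move=> m0 r0 H.
(* The doubled angles are 0, pi / 2 and pi. The first and last equations add up to 2 m u = 0; once u
   = 0, the first two read b v = 0 and n v = 0. *)
have H0 := H 0; have H1 := H (pi / 4); have H2 := H (pi / 2).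
have E1 : pi / 4 + pi / 4 = 0 + pi / 2 :> R by field.
have E2 : pi / 2 + pi / 2 = 0 + pi / 2 + pi / 2 :> R by field.
rewrite E1 rotxDpi2 rotyDpi2 in H1; rewrite E2 !(rotxDpi2, rotyDpi2) in H2.
rewrite addr0 in H0.
have rx : rotx n b 0 = n by rewrite /rotx cos0 sin0; ring.
have ry : roty n b 0 = b by rewrite /roty cos0 sin0; ring.
rewrite !rx !ry {rx ry E1 E2 H} in H0 H1 H2.
have u0 : u = 0.
  apply: (mulfI m0); rewrite mulr0.
  by apply: (mulfI (_ : (2 : R) != 0)) => //; lra.
split=> //; rewrite u0 !mulr0 !add0r in H0 H1.
apply: (mulfI r0); rewrite mulr0.
transitivity (n * (n * v) + b * (b * v)); first by ring.
by rewrite H0 H1 !mulr0 addr0.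
Qed.

Lemma double_angle_primitive (R : realType) (k m n b A B : R) (F : R -> R) :
  (forall z : R, is_derive z 1 F
    (- k * ((m - rotx n b (z + z)) * A - roty n b (z + z) * B))) ->
  forall z z', F z' = F z - k * (m * (z' - z) * A
     - (roty n b (z' + z') - roty n b (z + z)) / 2 * A
     + (rotx n b (z' + z') - rotx n b (z + z)) / 2 * B).
Proof.
move=> dF z z'.
(* [G] is [F] minus an explicit primitive of its prescribed derivative. *)
pose G t := F t + k * (m * t * A - roty n b (t + t) / 2 * A
                       + rotx n b (t + t) / 2 * B).
suff /eqP : G z = G z' by rewrite /G => /eqP E; lra.
apply: is_derive_0_is_cst => t.
have dx := is_derive_double (is_derive_rotx n b (t + t)).
have dy := is_derive_double (is_derive_roty n b (t + t)).
have := is_derive_lin (- (k * A / 2)) (k * B / 2)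
  (is_derive_lin (k * m * A) 0 (dF t) (is_derive_id t 1) (is_derive_id t 1)) dy dx.
rewrite (_ : (fun s => _) = G); last by apply/funext => s; rewrite /G /=; field.
by move=> dG; apply: is_derive_eq dG _; field.
Qed.

(* In coordinates where the metric is [P(z) (+) f0], [W] is the z-component of
   a Killing field and [Y1], [Y2] are the others.  Comparing the heights [z] and
   [z + pi], where [P] agrees, isolates the Hessian of [W]. *)
Lemma killing_rigidity (R : realType) (k m n b : R)
    (W Wx Wy Wxx Wxy Wyx Wyy Y1 Y1x Y1y Y2 Y2x Y2y : R -> R -> R -> R) :
  k != 0 -> m != 0 -> n ^+ 2 + b ^+ 2 != 0 ->
  (forall x y z : R, is_derive x 1 (fun t => W t y z) (Wx x y z)) ->
  (forall x y z : R, is_derive y 1 (fun t => W x t z) (Wy x y z)) ->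
  (forall x y z : R, is_derive z 1 (W x y) 0) ->
  (forall x y z : R, is_derive x 1 (fun t => Wx t y z) (Wxx x y z)) ->
  (forall x y z : R, is_derive x 1 (fun t => Wy t y z) (Wxy x y z)) ->
  (forall x y z : R, is_derive y 1 (fun t => Wx x t z) (Wyx x y z)) ->
  (forall x y z : R, is_derive y 1 (fun t => Wy x t z) (Wyy x y z)) ->
  (forall x y z : R, is_derive x 1 (fun t => Y1 t y z) (Y1x x y z)) ->
  (forall x y z : R, is_derive y 1 (fun t => Y1 x t z) (Y1y x y z)) ->
  (forall x y z : R, is_derive x 1 (fun t => Y2 t y z) (Y2x x y z)) ->
  (forall x y z : R, is_derive y 1 (fun t => Y2 x t z) (Y2y x y z)) ->
  (forall x y z : R, is_derive z 1 (Y1 x y)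
    (- k * ((m - rotx n b (z + z)) * Wx x y z - roty n b (z + z) * Wy x y z))) ->
  (forall x y z : R, is_derive z 1 (Y2 x y)
    (- k * ((m + rotx n b (z + z)) * Wy x y z - roty n b (z + z) * Wx x y z))) ->
  (forall x y z, (m + rotx n b (z + z)) * Y1x x y z
    + roty n b (z + z) * (Y2x x y z - W x y z) = 0) ->
  (forall x y z, (m - rotx n b (z + z)) * Y2y x y z
    + roty n b (z + z) * (Y1y x y z + W x y z) = 0) ->
  forall x y z, [/\ Wx x y z = 0, Wy x y z = 0, Y1x x y z = 0, Y2y x y z = 0 &
    Y1y x y z = - W x y z /\ Y2x x y z = W x y z].
Proof.
move=> k0 m0 r0 dWx dWy dWz dWxx dWxy dWyx dWyy dY1x dY1y dY2x dY2y dY1z dY2z K11 K22.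
have r0N : (- n) ^+ 2 + (- b) ^+ 2 != 0 by rewrite !sqrrN.
have rxN z : rotx (- n) (- b) z = - rotx n b z by rewrite /rotx; ring.
have ryN z : roty (- n) (- b) z = - roty n b z by rewrite /roty; ring.
(* [W] and its horizontal derivatives are independent of height, so they are constants when the
   equations for [Y1] and [Y2] are integrated in z. *)
have Wz x y z : W x y z = W x y 0 by exact: is_derive_0_is_cst.
have Wxz x y z : Wx x y z = Wx x y 0.
  apply: is_derive_uniq (dWx x y z) _.
  by rewrite (_ : (fun t => W t y z) = fun t => W t y 0) //; apply/funext.
have Wyz x y z : Wy x y z = Wy x y 0.
  apply: is_derive_uniq (dWy x y z) _.
  by rewrite (_ : (fun t => W x t z) = fun t => W x t 0) //; apply/funext.
have Y1z x y z z' : Y1 x y z' = Y1 x y z - k * (m * (z' - z) * Wx x y 0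
     - (roty n b (z' + z') - roty n b (z + z)) / 2 * Wx x y 0
     + (rotx n b (z' + z') - rotx n b (z + z)) / 2 * Wy x y 0).
  apply: (@double_angle_primitive _ k m n b _ _ (Y1 x y)) => t.
  by rewrite -(Wxz x y t) -(Wyz x y t); exact: dY1z.
have Y2z x y z z' : Y2 x y z' = Y2 x y z - k * (m * (z' - z) * Wy x y 0
     + (roty n b (z' + z') - roty n b (z + z)) / 2 * Wy x y 0
     + (rotx n b (z' + z') - rotx n b (z + z)) / 2 * Wx x y 0).
  (* The equation for [Y2] is that for [Y1] with (n, b) negated and (Wx, Wy) replaced by (Wy, -
     Wx). *)
  rewrite (@double_angle_primitive R k m (- n) (- b) (Wy x y 0) (- Wx x y 0) (Y2 x y) _ z z').
    by rewrite !rxN !ryN; ring.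
  move=> t; rewrite !rxN !ryN -(Wxz x y t) -(Wyz x y t).
  by apply: is_derive_eq (dY2z x y t) _; ring.
(* Differentiates horizontally a relation between the slices at two heights; uniqueness of
   derivatives does the rest. *)
have shift (F F' A A' B B' : R -> R) (c1 c2 x : R) (G : R -> R) (g : R) :
    (forall x : R, is_derive x 1 F (F' x)) -> (forall x : R, is_derive x 1 A (A' x)) ->
    (forall x : R, is_derive x 1 B (B' x)) -> is_derive x 1 G g ->
    (forall x, G x = F x - k * (c1 * A x + c2 * B x)) ->
    g = F' x - k * (c1 * A' x + c2 * B' x).
  move=> dF dA dB dG GE; apply: is_derive_uniq dG _.
  have := is_derive_lin (- (k * c1)) (- (k * c2)) (dF x) (dA x) (dB x).
  rewrite (_ : (fun s => _) = G); last by apply/funext => s; rewrite GE; ring.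
  by move=> dG'; apply: is_derive_eq dG' _; ring.
have Y1xz x y z z' : Y1x x y z' = Y1x x y z - k * ((m * (z' - z)
     - (roty n b (z' + z') - roty n b (z + z)) / 2) * Wxx x y 0
     + (rotx n b (z' + z') - rotx n b (z + z)) / 2 * Wxy x y 0).
  apply: (shift _ (fun x => Y1x x y z) _ (fun x => Wxx x y 0) _ (fun x => Wxy x y 0)
    _ _ x _ _ (fun x => dY1x x y z) (fun x => dWxx x y 0) (fun x => dWxy x y 0)
    (dY1x x y z')) => t.
  by rewrite (Y1z t y z z'); ring.
have Y2xz x y z z' : Y2x x y z' = Y2x x y z - k * (
     (rotx n b (z' + z') - rotx n b (z + z)) / 2 * Wxx x y 0 + (m * (z' - z)
     + (roty n b (z' + z') - roty n b (z + z)) / 2) * Wxy x y 0).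
  apply: (shift _ (fun x => Y2x x y z) _ (fun x => Wxx x y 0) _ (fun x => Wxy x y 0)
    _ _ x _ _ (fun x => dY2x x y z) (fun x => dWxx x y 0) (fun x => dWxy x y 0)
    (dY2x x y z')) => t.
  by rewrite (Y2z t y z z'); ring.
have Y1yz x y z z' : Y1y x y z' = Y1y x y z - k * ((m * (z' - z)
     - (roty n b (z' + z') - roty n b (z + z)) / 2) * Wyx x y 0
     + (rotx n b (z' + z') - rotx n b (z + z)) / 2 * Wyy x y 0).
  apply: (shift _ (fun y => Y1y x y z) _ (fun y => Wyx x y 0) _ (fun y => Wyy x y 0)
    _ _ y _ _ (fun y => dY1y x y z) (fun y => dWyx x y 0) (fun y => dWyy x y 0)
    (dY1y x y z')) => t.
  by rewrite (Y1z x t z z'); ring.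
have Y2yz x y z z' : Y2y x y z' = Y2y x y z - k * (
     (rotx n b (z' + z') - rotx n b (z + z)) / 2 * Wyx x y 0 + (m * (z' - z)
     + (roty n b (z' + z') - roty n b (z + z)) / 2) * Wyy x y 0).
  apply: (shift _ (fun y => Y2y x y z) _ (fun y => Wyx x y 0) _ (fun y => Wyy x y 0)
    _ _ y _ _ (fun y => dY2y x y z) (fun y => dWyx x y 0) (fun y => dWyy x y 0)
    (dY2y x y z')) => t.
  by rewrite (Y2z x t z z'); ring.
have pi0 : k * (m * pi) != 0 by rewrite !mulf_neq0 // gt_eqF // pi_gt0.
(* Between z and z + pi the periodic terms agree and only the linear drift k m pi remains, so the
   difference of the two instances of [K11] is a multiple of a double-angle equation in the Hessian
   entries. *)
have Hx x y : Wxx x y 0 = 0 /\ Wxy x y 0 = 0.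
  apply: (double_angle_coef_eq0 m0 r0) => z; apply: (mulfI pi0); rewrite mulr0.
  transitivity (
    ((m + rotx n b (z + z)) * Y1x x y z + roty n b (z + z) * (Y2x x y z - W x y z))
    - ((m + rotx n b (z + pi + (z + pi))) * Y1x x y (z + pi)
       + roty n b (z + pi + (z + pi)) * (Y2x x y (z + pi) - W x y (z + pi)))).
    rewrite (Y1xz x y z (z + pi)) (Y2xz x y z (z + pi)) roty_double_pi rotx_double_pi.
    by rewrite (Wz x y z) (Wz x y (z + pi)); ring.
  by rewrite !K11 subrr.
have Hy x y : Wyy x y 0 = 0 /\ - Wyx x y 0 = 0.
  apply: (double_angle_coef_eq0 m0 r0N) => z; apply: (mulfI pi0); rewrite mulr0.
  transitivity (
    ((m - rotx n b (z + z)) * Y2y x y z + roty n b (z + z) * (Y1y x y z + W x y z))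
    - ((m - rotx n b (z + pi + (z + pi))) * Y2y x y (z + pi)
       + roty n b (z + pi + (z + pi)) * (Y1y x y (z + pi) + W x y (z + pi)))).
    rewrite (Y1yz x y z (z + pi)) (Y2yz x y z (z + pi)) roty_double_pi rotx_double_pi !rxN !ryN.
    by rewrite (Wz x y z) (Wz x y (z + pi)); ring.
  by rewrite !K22 subrr.
(* With the Hessian zero, [Y1x] and [Y2x] no longer depend on height, so [K11] at all heights [z']
   is again a double-angle equation. *)
have Dx x y z : Y1x x y z = 0 /\ Y2x x y z - W x y z = 0.
  apply: (double_angle_coef_eq0 m0 r0) => z'; rewrite -[RHS](K11 x y z').
  have [xx xy] := Hx x y.
  by rewrite (Y1xz x y z z') (Y2xz x y z z') xx xy (Wz x y z) (Wz x y z'); ring.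
have Dy x y z : Y2y x y z = 0 /\ - (Y1y x y z + W x y z) = 0.
  apply: (double_angle_coef_eq0 m0 r0N) => z'; rewrite -[RHS](K22 x y z') rxN ryN.
  have [yy yx] := Hy x y; have {}yx : Wyx x y 0 = 0 by lra.
  by rewrite (Y1yz x y z z') (Y2yz x y z z') yy yx (Wz x y z) (Wz x y z'); ring.
have Y1yE x y z : Y1y x y z = - W x y z by have [_] := Dy x y z; lra.
have Y2xE x y z : Y2x x y z = W x y z by have [_] := Dx x y z; lra.
have Y1cst x x' y z : Y1 x y z = Y1 x' y z.
  apply: (@is_derive_0_is_cst _ (fun t => Y1 t y z)) => t.
  by rewrite -(Dx t y z).1; exact: dY1x.
have Y2cst x y y' z : Y2 x y z = Y2 x y' z.
  apply: (@is_derive_0_is_cst _ (fun t => Y2 x t z)) => t.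
  by rewrite -(Dy x t z).1; exact: dY2y.
(* [Y1] does not depend on x, hence neither does its y-derivative, which is [- W]; [Y2] gives the
   same in y. *)
have Wcx x x' y z : W x y z = W x' y z.
  apply: oppr_inj; rewrite -!Y1yE; apply: is_derive_uniq (dY1y x y z) _.
  by rewrite (_ : (fun t => Y1 x t z) = fun t => Y1 x' t z) //; apply/funext.
have Wcy x y y' z : W x y z = W x y' z.
  rewrite -!Y2xE; apply: is_derive_uniq (dY2x x y z) _.
  by rewrite (_ : (fun t => Y2 t y z) = fun t => Y2 t y' z) //; apply/funext.
move=> x y z; split; [| |exact: (Dx x y z).1|exact: (Dy x y z).1|by []].
- apply: is_derive_uniq (dWx x y z) _.
  rewrite (_ : (fun t => W t y z) = cst (W x y z)); last first.
    by apply/funext => t; exact: Wcx.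
  exact: is_derive_cst.
- apply: is_derive_uniq (dWy x y z) _.
  rewrite (_ : (fun t => W x t z) = cst (W x y z)); last first.
    by apply/funext => t; exact: Wcy.
  exact: is_derive_cst.
Qed.

(** * Left-invariant metrics in coordinates *)

Lemma innerE (R : realType) (n : nat) (g : 'rV[R]_n -> 'M[R]_n) (p u v : 'rV[R]_n) :
  inner g p u v = \sum_i \sum_j u 0 i * g p i j * v 0 j.
Proof.
rewrite /inner mxE exchange_big; apply: eq_bigr => j _.
by rewrite !mxE mulr_suml.
Qed.

Lemma inner_delta (R : realType) (n : nat) (g : 'rV[R]_n -> 'M[R]_n)
    (p : 'rV[R]_n) (i j : 'I_n) :
  inner g p (delta_mx 0 i) (delta_mx 0 j) = g p i j.
Proof. by rewrite /inner -rowE trmx_delta -colE !mxE. Qed.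

Lemma metric_sym (R : realType) (n : nat) (g : 'rV[R]_n -> 'M[R]_n) :
  riemannian_metric g -> forall p i j, g p i j = g p j i.
Proof. by case=> _ gsym _ p i j; rewrite -inner_delta gsym inner_delta. Qed.

Lemma metric_unit (R : realType) (n : nat) (g : 'rV[R]_n -> 'M[R]_n)
    (p : 'rV[R]_n) :
  riemannian_metric g -> g p \in unitmx.
Proof.
case=> _ _ gpos; rewrite -row_free_unit -kermx_eq0; apply/eqP/row_matrixP => i.
rewrite row0; apply/eqP/negP => /negP /(gpos p).
by rewrite /inner -row_mul mulmx_ker row0 mul0mx mxE ltxx.
Qed.

(** If u is row i of the inverse, then u g is the i-th basis vector, so the diagonal entry equals
    g(u, u). *)
Lemma metric_inv_gt0 (R : realType) (n : nat) (g : 'rV[R]_n -> 'M[R]_n)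
    (p : 'rV[R]_n) (i : 'I_n) :
  riemannian_metric g -> 0 < invmx (g p) i i.
Proof.
move=> gR; have gU := metric_unit p gR.
have gT : (g p)^T = g p by apply/matrixP => k l; rewrite mxE (metric_sym gR).
pose u := row i (invmx (g p)).
have uE : u *m g p = delta_mx 0 i by rewrite -row_mul mulVmx // row1.
have u0 : u != 0.
  apply/eqP => u0; move: uE; rewrite u0 mul0mx => /rowP/(_ i)/eqP.
  by rewrite !mxE !eqxx eq_sym oner_eq0.
case: gR => _ _ /(_ p u u0); rewrite /inner uE => h.
by move: h; rewrite -rowE !mxE.
Qed.

(** Lowering the index cancels the inverse matrix, leaving Christoffel symbols of the first kind. *)
Lemma lower_christoffel (R : realType) (n : nat) (g : 'rV[R]_n -> 'M[R]_n)
    (p : 'rV[R]_n) (l i j : 'I_n) :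
  riemannian_metric g ->
  \sum_k g p l k * christoffel g k i j p =
  2^-1 * (partial i (fun q => g q j l) p + partial j (fun q => g q i l) p
          - partial l (fun q => g q i j) p).
Proof.
move=> gR; pose c := \col_k (partial i (fun q => g q j k) p
  + partial j (fun q => g q i k) p - partial k (fun q => g q i j) p).
transitivity (2^-1 * (g p *m (invmx (g p) *m c)) l 0); last first.
  by rewrite mulmxA mulmxV ?metric_unit // mul1mx mxE.
rewrite mxE mulr_sumr; apply: eq_bigr => k _.
rewrite /christoffel mulrCA; congr (_ * (_ * _)); rewrite mxE.
by apply: eq_bigr => r _; rewrite mxE.
Qed.

Lemma lower_nabla (R : realType) (n : nat) (g : 'rV[R]_n -> 'M[R]_n)
    (X : 'rV[R]_n -> 'rV[R]_n) (p : 'rV[R]_n) (l i : 'I_n) :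
  riemannian_metric g ->
  \sum_k g p l k * nabla g X p i k =
  \sum_k g p l k * partial i (fun q => X q 0 k) p
  + \sum_j 2^-1 * (partial i (fun q => g q j l) p + partial j (fun q => g q i l) p
          - partial l (fun q => g q i j) p) * X p 0 j.
Proof.
move=> gR; under eq_bigr => k _ do rewrite mxE mulrDr mulr_sumr.
rewrite big_split /=; congr (_ + _); rewrite exchange_big /=.
apply: eq_bigr => j _; rewrite -lower_christoffel // mulr_suml.
by apply: eq_bigr => k _; rewrite mulrA.
Qed.

(** * The group law and its left translations in coordinates *)

Lemma sum3E (R : nmodType) (F : 'I_3 -> R) : \sum_i F i = F 0 + F 1 + F 2.
Proof.
by rewrite !big_ord_recl big_ord0 addr0 addrA; congr (F _ + F _ + F _); apply: val_inj.
Qed.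

Lemma ord3P (P : 'I_3 -> Prop) : P 0 -> P 1 -> P 2 -> forall i, P i.
Proof.
move=> P0 P1 P2 [[|[|[|//]]] Hi].
- by rewrite (_ : Ordinal Hi = 0) //; apply: val_inj.
- by rewrite (_ : Ordinal Hi = 1) //; apply: val_inj.
- by rewrite (_ : Ordinal Hi = 2) //; apply: val_inj.
Qed.

Lemma vec3E (R : realType) (x y z : R) :
  (vec3 x y z 0 0 = x) * (vec3 x y z 0 1 = y) * (vec3 x y z 0 2 = z).
Proof. by rewrite !mxE. Qed.

Lemma vec3_eta (R : realType) (p : 'rV[R]_3) : vec3 (p 0 0) (p 0 1) (p 0 2) = p.
Proof. by apply/rowP; apply: ord3P; rewrite !mxE. Qed.

Definition mat3 (R : realType) (a00 a01 a02 a10 a11 a12 a20 a21 a22 : R) : 'M[R]_3 :=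
  \matrix_(i, j) (nth [::] [:: [:: a00; a01; a02]; [:: a10; a11; a12]; [:: a20; a21; a22]] i)`_j.

Lemma mat3E (R : realType) (a00 a01 a02 a10 a11 a12 a20 a21 a22 : R) :
  let A := mat3 a00 a01 a02 a10 a11 a12 a20 a21 a22 in
  ((A 0 0 = a00) * (A 0 1 = a01) * (A 0 2 = a02)) *
  ((A 1 0 = a10) * (A 1 1 = a11) * (A 1 2 = a12)) *
  ((A 2 0 = a20) * (A 2 1 = a21) * (A 2 2 = a22)).
Proof. by rewrite /= !mxE. Qed.

(** Vectors are rows and the matrix acts on the right, hence the transpose of the usual rotation
    matrix. *)
Definition rot3 (R : realType) (z : R) : 'M[R]_3 :=
  mat3 (cos z) (sin z) 0 (- sin z) (cos z) 0 0 0 1.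

Lemma E2_mulE (R : realType) (a b : 'rV[R]_3) : E2_mul a b = a + b *m rot3 (a 0 2).
Proof.
by apply/rowP; apply: ord3P; rewrite !mxE sum3E !mat3E /=; ring.
Qed.

Lemma mulmxr_continuous (R : realType) (n k : nat) (A : 'M[R]_(n, k)) :
  continuous (fun u : 'rV[R]_n => u *m A).
Proof.
move=> u; apply: (@cvg_rV _ _ _ _ (nbhs_filter u)) => i.
rewrite mxE; under eq_cvg => v do rewrite mxE.
apply: cvg_big => [|j _]; first exact: add_continuous.
by apply: cvgM; [exact: coord_continuous|exact: cvg_cst].
Qed.

Lemma diff_E2_mul (R : realType) (a p u : 'rV[R]_3) :
  'd (E2_mul a) p u = u *m rot3 (a 0 2).
Proof.
have -> : E2_mul a = cst a + mulmxr (rot3 (a 0 2)).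
  by apply/funext => b; rewrite E2_mulE.
have cM : continuous (mulmxr (rot3 (a 0 2)) : 'rV[R]_3 -> 'rV[R]_3).
  exact: mulmxr_continuous.
have dM := linear_differentiable p cM.
have dE := diffD (differentiable_cst a p) dM.
have dcE := congr1 (@^~ u) (@diff_cst _ _ _ a p).
have dME := congr1 (@^~ u) (diff_lin p cM).
by rewrite dE; exact: etrans (congr2 +%R dcE dME) (add0r _).
Qed.

(** Translation by [p] carries the identity to [p] with differential [rot3]; as this matrix is
    orthogonal, the rows of its transpose are the vectors at the identity sent to the coordinate
    frame at [p]. *)
Lemma left_invariantE (R : realType) (g : 'rV[R]_3 -> 'M[R]_3) :
  left_invariant g ->
  forall p i j, g p i j = inner g 0 (row i (rot3 (p 0 2))^T) (row j (rot3 (p 0 2))^T).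
Proof.
move=> gL p i j; set M := rot3 _.
have MM : M^T *m M = 1%:M.
  have := cos2Dsin2 (p 0 2) => cs.
  apply/matrixP; apply: ord3P; apply: ord3P;
    rewrite !mxE sum3E ![M^T _ _]mxE !mat3E /= ?mulr1n ?mulr0n; nra.
have := gL p 0 (row i M^T) (row j M^T).
rewrite !diff_E2_mul E2_mulE mul0mx addr0 -!row_mul MM !row1 => <-.
by rewrite inner_delta.
Qed.

(* The Gram matrix, in the coordinate frame at height [z], of the left-invariant
   metric with Gram matrix [[m+n, b, d], [b, m-n, e], [d, e, f]] at the identity. *)
Definition E2_gram (R : realType) (m n b d e f z : R) : 'M[R]_3 :=
  mat3 (m + rotx n b (z + z)) (roty n b (z + z)) (rotx d e z)
       (roty n b (z + z)) (m - rotx n b (z + z)) (roty d e z)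
       (rotx d e z) (roty d e z) f.

Definition E2_gram' (R : realType) (m n b d e f z : R) : 'M[R]_3 :=
  mat3 (- 2 * roty n b (z + z)) (2 * rotx n b (z + z)) (- roty d e z)
       (2 * rotx n b (z + z)) (2 * roty n b (z + z)) (rotx d e z)
       (- roty d e z) (rotx d e z) 0.

Lemma left_invariant_gram (R : realType) (g : 'rV[R]_3 -> 'M[R]_3) :
  riemannian_metric g -> left_invariant g ->
  exists m n b d e f, g = fun p => E2_gram m n b d e f (p 0 2).
Proof.
move=> gR gL; pose G := g 0.
(* The horizontal block at the identity is split into its scalar part [m] and its traceless part
   [(n, b)], which turns by 2z; the mixed entries [(d, e)] turn by z. *)
exists ((G 0 0 + G 1 1) / 2), ((G 0 0 - G 1 1) / 2), (G 0 1), (G 0 2), (G 1 2), (G 2 2).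
apply/funext => p; apply/matrixP => i j; rewrite left_invariantE // innerE.
have rE k l : row k (rot3 (p 0 2))^T 0 l = rot3 (p 0 2) l k by rewrite 2!mxE.
under eq_bigr => k _ do under eq_bigr => l _ do rewrite !rE.
rewrite !sum3E {rE}; move: i j.
have gs := metric_sym gR 0.
have cs := cos2Dsin2 (p 0 2).
have s2 : sin (p 0 2) ^+ 2 = 1 - cos (p 0 2) ^+ 2 by lra.
apply: ord3P; apply: ord3P;
  rewrite !mat3E ?(gs 1 0) ?(gs 2 0) ?(gs 2 1) -/G /rotx /roty ?cosD ?sinD;
  (field: s2; by []).
Qed.

Lemma is_derive_gram (R : realType) (m n b d e f z : R) (i j : 'I_3) :
  is_derive z 1 (fun t => E2_gram m n b d e f t i j) (E2_gram' m n b d e f z i j).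
Proof.
have dx := is_derive_double (is_derive_rotx n b (z + z)).
have dy := is_derive_double (is_derive_roty n b (z + z)).
have dp := is_derive_rotx d e z; have dq := is_derive_roty d e z.
move: i j; apply: ord3P; apply: ord3P.
all: under eq_fun do rewrite mat3E; rewrite mat3E //.
- by apply: is_derive_eq (is_deriveD (is_derive_cst m _ _) dx) _; ring.
- by apply: is_derive_eq (is_deriveB (is_derive_cst m _ _) dx) _; ring.
- exact: is_derive_cst.
Qed.

(** * Derivatives and positivity of the Gram matrix *)

Lemma partial_coordE (R : realType) (n : nat) (h : R -> R) (i k : 'I_n) (p : 'rV[R]_n) :
  partial i (fun q => h (q 0 k)) p = if i == k then 'D_1 h (p 0 k) else 0.
Proof.
transitivity ('D_((i == k)%:R : R) h (p 0 k)); last first.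
  by case: ifP => // _; exact: derive0.
have E : (fun t : R => t^-1 *: (((fun q : 'rV[R]_n => h (q 0 k)) \o shift p) (t *: delta_mx 0 i)
      - h (p 0 k)))
    = (fun t : R => t^-1 *: ((h \o shift (p 0 k)) (t *: ((i == k)%:R : R)) - h (p 0 k))).
  apply/funext => t /=; congr (_ *: (h _ - _)).
  by rewrite !mxE eqxx /= eq_sym.
by rewrite /partial /derive E.
Qed.

Lemma partial_gram (R : realType) (m n b d e f : R) (k i j : 'I_3) (p : 'rV[R]_3) :
  partial k (fun q => E2_gram m n b d e f (q 0 2) i j) p
  = if k == 2 then E2_gram' m n b d e f (p 0 2) i j else 0.
Proof.
rewrite (partial_coordE (fun z => E2_gram m n b d e f z i j)).
by case: ifP => // _; case: (is_derive_gram m n b d e f (p 0 2) i j).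
Qed.

Lemma vec3_neq0 (R : realType) (x y z : R) :
  [|| x != 0, y != 0 | z != 0] -> vec3 x y z != 0.
Proof.
apply: contraTneq => /rowP v0.
by have := (v0 0, v0 1, v0 2); rewrite !mxE /= => -[[-> ->] ->]; rewrite eqxx.
Qed.

(** [D] is the determinant of the horizontal block at the identity, and the last quantity is its
    Schur complement: the squared length of d/dz minus its horizontal projection. *)
Lemma gram_gt0 (R : realType) (m n b d e f : R) :
  riemannian_metric (fun p : 'rV[R]_3 => E2_gram m n b d e f (p 0 2)) ->
  let D := m ^+ 2 - n ^+ 2 - b ^+ 2 in
  [/\ 0 < m, 0 < D &
   0 < f - (d * (((m - n) * d - b * e) / D) + e * (((m + n) * e - b * d) / D))].
Proof.
case=> _ _ gpos D.
have r0 u v : (rotx u v 0 = u) * (roty u v 0 = v) :> Type.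
  by rewrite /rotx /roty cos0 sin0; split; ring.
have pos x y z : [|| x != 0, y != 0 | z != 0] ->
    0 < (m + n) * x ^+ 2 + (m - n) * y ^+ 2 + f * z ^+ 2
        + 2 * (b * x * y + d * x * z + e * y * z).
  move=> /vec3_neq0 /(gpos 0); rewrite innerE !sum3E !vec3E !mat3E mxE addr0 !r0.
  by congr (0 < _); ring.
have p0 : 0 < m + n.
  by have := pos 1 0 0; rewrite oner_eq0 => /(_ isT); congr (0 < _); ring.
have p1 : 0 < m - n.
  by have := pos 0 1 0; rewrite oner_eq0 orbT => /(_ isT); congr (0 < _); ring.
have D0 : 0 < D.
  (* This vector is orthogonal to d/dx and has squared length (m + n) D. *)
  have := pos (- b) (m + n) 0; rewrite (gt_eqF p0) orbT => /(_ isT).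
  rewrite (_ : _ + _ = (m + n) * D); first by rewrite pmulr_rgt0.
  by rewrite /D; ring.
split=> //; first by lra.
have := pos (- (((m - n) * d - b * e) / D)) (- (((m + n) * e - b * d) / D)) 1.
rewrite oner_eq0 !orbT => /(_ isT); congr (0 < _).
by rewrite /D; field; rewrite gt_eqF.
Qed.

(** The symbol as a function of the height alone, with the derivatives of the metric already
    evaluated, so that [partial_coordE] applies to it. *)
Definition height_christoffel (R : realType) (m n b d e f : R) (k i j : 'I_3) (z : R) : R :=
  2^-1 * \sum_(l < 3) invmx (E2_gram m n b d e f z) k l *
    ((if i == 2 then E2_gram' m n b d e f z j l else 0)
     + (if j == 2 then E2_gram' m n b d e f z i l else 0)
     - (if l == 2 then E2_gram' m n b d e f z i j else 0)).

Lemma christoffel_gram (R : realType) (m n b d e f : R) (k i j : 'I_3) :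
  christoffel (fun p : 'rV[R]_3 => E2_gram m n b d e f (p 0 2)) k i j
  = fun p => height_christoffel m n b d e f k i j (p 0 2).
Proof.
apply/funext => p; rewrite /christoffel; congr (_ * _); apply: eq_bigr => l _.
by rewrite !partial_gram.
Qed.

Lemma flat_gram_round (R : realType) (m n b d e f : R) :
  let g := fun p : 'rV[R]_3 => E2_gram m n b d e f (p 0 2) in
  riemannian_metric g -> flat g -> n ^+ 2 + b ^+ 2 = 0.
Proof.
move=> g gR gF.
have cpart l i j k p : k != 2 -> partial k (christoffel g l i j) p = 0.
  by move=> /negPf k2; rewrite christoffel_gram partial_coordE k2.
have i22 := metric_inv_gt0 0 2 gR.
(* This is g(R(d/dx, d/dy) d/dy, d/dx) at the origin. Horizontal derivatives of the symbols vanish,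
   so only the quadratic terms remain, and they add up to [invmx (g 0) 2 2] times n^2 + b^2. *)
have : \sum_l g 0 0 l * curvature g l 0 1 1 0 = 0.
  by rewrite big1 // => l _; rewrite gF mulr0.
have -> : \sum_l g 0 0 l * curvature g l 0 1 1 0 =
    \sum_k (christoffel g k 1 1 0 * (\sum_l g 0 0 l * christoffel g l 0 k 0)
     - christoffel g k 0 1 0 * (\sum_l g 0 0 l * christoffel g l 1 k 0)).
  rewrite /curvature; under eq_bigr => l _ do
    rewrite !cpart // subrr add0r mulr_sumr.
  rewrite exchange_big; apply: eq_bigr => k _.
  rewrite !mulr_sumr -sumrB; apply: eq_bigr => l _; ring.
under eq_bigr => k _ do rewrite !lower_christoffel // !partial_gram.
rewrite sum3E !christoffel_gram /height_christoffel.
rewrite !sum3E /= !mat3E.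
have r0 u v : (rotx u v 0 = u) * (roty u v 0 = v) :> Type.
  by rewrite /rotx /roty cos0 sin0; split; ring.
rewrite mxE addr0 !r0 => H.
apply: (mulfI (lt0r_neq0 i22)); rewrite mulr0 -[RHS]H /g mxE; by field.
Qed.

(** * The flat case *)

(** Only the mixed entries of the metric vary. With both lower indices horizontal no such derivative
    occurs; with exactly one equal to z, the two occurrences, both at [l == 2], cancel. *)
Lemma round_christoffel_eq0 (R : realType) (m d e f : R) (k i j : 'I_3)
    (p : 'rV[R]_3) :
  ~~ ((i == 2) && (j == 2)) ->
  christoffel (fun p : 'rV[R]_3 => E2_gram m 0 0 d e f (p 0 2)) k i j p = 0.
Proof.
move=> ij; rewrite christoffel_gram /height_christoffel big1 ?mulr0 // => l _.
suff -> : (if i == 2 then E2_gram' m 0 0 d e f (p 0 2) j l else 0)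
     + (if j == 2 then E2_gram' m 0 0 d e f (p 0 2) i l else 0)
     - (if l == 2 then E2_gram' m 0 0 d e f (p 0 2) i j else 0) = 0.
  by rewrite mulr0.
have r0 z : (rotx 0 0 z = 0 :> R) * (roty 0 0 z = 0 :> R).
  by rewrite /rotx /roty; split; ring.
move: i j l ij; apply: ord3P; apply: ord3P; apply: ord3P => //= _;
  rewrite ?mat3E ?r0; ring.
Qed.

(** A symbol survives only when both lower indices are z, and it depends on z alone. For [i != j],
    each derivative and each product in the curvature would need both [i] and [j] to be z. *)
Lemma flat_round (R : realType) (m d e f : R) :
  flat (fun p : 'rV[R]_3 => E2_gram m 0 0 d e f (p 0 2)).
Proof.
set g := (fun p => _).
have chr0 k i j : ~~ ((i == 2) && (j == 2)) -> christoffel g k i j = fun=> 0.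
  by move=> ij; apply/funext => p; rewrite round_christoffel_eq0.
have dchr l i j k p : i != j -> partial i (christoffel g l j k) p = 0.
  move=> ij; have [jk|jk] := boolP ((j == 2) && (k == 2)); last first.
    by rewrite chr0 // /partial derive_cst.
  rewrite christoffel_gram partial_coordE.
  by have /andP[/eqP <- _] := jk; rewrite (negPf ij).
have mchr a l i j k p : i != j -> christoffel g a j k p * christoffel g l i a p = 0.
  move=> ij; have [/andP[/eqP j2 _]|jk] := boolP ((j == 2) && (k == 2)).
    by rewrite (chr0 l i a) ?mulr0 // -j2 (negPf ij).
  by rewrite chr0 // mul0r.
move=> l i j k p; rewrite /curvature.
have [->|ij] := eqVneq i j.
  by rewrite subrr add0r big1 // => a _; rewrite subrr.
have ji : j != i by rewrite eq_sym.
rewrite (dchr l i j) // (dchr l j i) // subrr add0r big1 // => a _.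
by rewrite (mchr a l i j) // (mchr a l j i) // subrr.
Qed.

Lemma smooth_cst (R : realType) (n : nat) (c : R) : smooth (fun _ : 'rV[R]_n => c).
Proof.
move=> k; elim: k c => [|k IHk] c /=; split=> //.
- exact: cst_continuous.
- exact: cst_continuous.
- move=> i; split; first by move=> p; exact: derivable_cst.
  rewrite (_ : partial i _ = fun=> 0) //.
  by apply/funext => p; exact: derive_cst.
Qed.

Lemma sym_space_round (R : realType) (m d e f : R) (p : 'rV[R]_3) :
  sym_space (fun p : 'rV[R]_3 => E2_gram m 0 0 d e f (p 0 2)) p (delta_mx 0 0).
Proof.
exists (fun=> delta_mx 0 0).
have pc i k q : partial i (fun _ : 'rV[R]_3 => (delta_mx 0 0 : 'rV[R]_3) 0 k) q = 0.
  exact: derive_cst.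
split=> //; [split|].
- by move=> k; exact: smooth_cst.
- move=> q; apply/matrixP => i j; rewrite mxE [RHS]mxE big1 // => k _.
  rewrite !pc partial_gram !mulr0 !addr0 mxE eqxx /=.
  by have [->|] := eqVneq k 0; rewrite ?mulr0 // mul0r.
- apply/matrixP => i k; rewrite mxE [RHS]mxE pc add0r big1 // => j _.
  have [->|j0] := eqVneq j 0; last by rewrite mxE (negPf j0) andbF mulr0.
  by rewrite round_christoffel_eq0 ?mul0r // andbF.
Qed.

Lemma set_dim_neq0 (R : realType) (n : nat) (S : set 'rV[R]_n) :
  set_dim S <> 0%N <-> exists2 v, S v & v != 0.
Proof.
split=> [|[v Sv v0]].
- apply: contra_notP => noS; apply/eqP; rewrite -leqn0.
  apply/bigmax_leqP => k /asboolP[t [tfree tS]]; rewrite leqNgt.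
  apply/negP => k0; apply: noS; exists (tnth t (Ordinal k0)).
    by apply: tS; exact: mem_tnth.
  by apply: (free_not0 tfree); exact: mem_tnth.
(* The size 1 must lie in the range of the maximum; in dimension 0 there is no nonzero vector. *)
- have n0 : (1 < n.+1)%N.
    case: n S v Sv v0 => // S v _ /eqP; case.
    by apply/rowP => -[].
  have := @leq_bigmax_cond _ (fun k : 'I_n.+1 => `[< exists t : k.-tuple 'rV[R]_n,
     free t /\ [set` t] `<=` S >]) (@nat_of_ord _) (Ordinal n0).
  move=> H S0; move: H; rewrite -/(set_dim S) S0 /= => H.
  suff /H : `[< exists t : 1.-tuple 'rV[R]_n, free t /\ [set` t] `<=` S >] by [].
  apply/asboolP; exists [tuple v]; split; first by rewrite seq1_free.
  by move=> w /=; rewrite inE => /eqP ->.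
Qed.

(** * The non-flat case *)

Lemma smooth_derivable (R : realType) (n : nat) (h : 'rV[R]_n -> R) :
  smooth h -> forall k q, derivable h q (delta_mx 0 k : 'rV[R]_n).
Proof. by move=> sh k; have [_ /(_ k) []] := sh 1%N. Qed.

Lemma smooth_partial (R : realType) (n : nat) (h : 'rV[R]_n -> R) (k : 'I_n) :
  smooth h -> smooth (partial k h).
Proof. by move=> sh r; have [_ /(_ k) []] := sh r.+1. Qed.

Lemma smooth_continuous (R : realType) (n : nat) (h : 'rV[R]_n -> R) :
  smooth h -> continuous h.
Proof. by move=> sh; have [] := sh 0%N. Qed.

Lemma is_derive_smooth_curve (R : realType) (n : nat) (h : 'rV[R]_n -> R)
    (c : R -> 'rV[R]_n) (v : 'rV[R]_n) (t0 : R) :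
  smooth h -> (forall k, is_derive t0 1 (fun t => c t 0 k) (v 0 k)) ->
  is_derive t0 1 (h \o c) (\sum_(k < n) partial k h (c t0) * v 0 k).
Proof.
move=> sh; apply: is_derive_curve; first exact: smooth_derivable.
by move=> k; apply/smooth_continuous/smooth_partial.
Qed.

(* Coordinates [(x, y, z)] in which d/dz becomes orthogonal to d/dx and d/dy
   when [rotx u v z, roty u v z] is the orthogonal projection of d/dz on their
   span. *)
Definition shear (R : realType) (u v x y z : R) : 'rV[R]_3 :=
  vec3 (x - roty u v z) (y + rotx u v z) z.

(** The third coordinate curve has velocity d/dz - [rotx u v z] d/dx - [roty u v z] d/dy. *)
Lemma is_derive_shear (R : realType) (h : 'rV[R]_3 -> R) (u v x y z : R) :
  smooth h ->
  [/\ is_derive x 1 (fun t => h (shear u v t y z)) (partial 0 h (shear u v x y z)),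
      is_derive y 1 (fun t => h (shear u v x t z)) (partial 1 h (shear u v x y z)) &
      is_derive z 1 (fun t => h (shear u v x y t))
        (partial 2 h (shear u v x y z) - rotx u v z * partial 0 h (shear u v x y z)
         - roty u v z * partial 1 h (shear u v x y z))].
Proof.
move=> sh.
have drx := is_derive_rotx u v z; have dry := is_derive_roty u v z.
have curve (c : R -> 'rV[R]_3) (t0 a0 a1 a2 : R) :
    is_derive t0 1 (fun t => c t 0 0) a0 -> is_derive t0 1 (fun t => c t 0 1) a1 ->
    is_derive t0 1 (fun t => c t 0 2) a2 ->
    is_derive t0 1 (fun t => h (c t)) (partial 0 h (c t0) * a0
      + partial 1 h (c t0) * a1 + partial 2 h (c t0) * a2).
  move=> d0 d1 d2.
  have := @is_derive_smooth_curve R 3 h c (vec3 a0 a1 a2) t0 sh.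
  rewrite sum3E !vec3E; apply.
  by apply: ord3P; rewrite vec3E.
have dc (F : R -> R) (t0 a : R) : (forall t, F t = a) -> is_derive t0 1 F 0.
  by move=> /(funext (g := fun=> a)) ->; exact: is_derive_cst.
have dl (F : R -> R) (t0 a : R) : (forall t, F t = t + a) -> is_derive t0 1 F 1.
  move=> /(funext (g := fun t => t + a)) ->.
  by apply: is_derive_eq (is_deriveD (is_derive_id t0 1) (is_derive_cst a t0 1)) _; rewrite addr0.
split.
- apply: is_derive_eq (curve (fun t => shear u v t y z) x 1 0 0 _ _ _) _.
  + by apply: (dl _ _ (- roty u v z)) => t; rewrite vec3E.
  + by apply: (dc _ _ (y + rotx u v z)) => t; rewrite vec3E.
  + by apply: (dc _ _ z) => t; rewrite vec3E.
  + by move: (partial 0 h _) (partial 1 h _) (partial 2 h _) => a0 a1 a2; ring.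
- apply: is_derive_eq (curve (fun t => shear u v x t z) y 0 1 0 _ _ _) _.
  + by apply: (dc _ _ (x - roty u v z)) => t; rewrite vec3E.
  + by apply: (dl _ _ (rotx u v z)) => t; rewrite vec3E.
  + by apply: (dc _ _ z) => t; rewrite vec3E.
  + by move: (partial 0 h _) (partial 1 h _) (partial 2 h _) => a0 a1 a2; ring.
- apply: is_derive_eq (curve (fun t => shear u v x y t) z
    (- rotx u v z) (- roty u v z) 1 _ _ _) _.
  + under eq_fun do rewrite vec3E.
    by apply: is_derive_eq (is_deriveB (is_derive_cst x z 1) dry) _; rewrite sub0r.
  + under eq_fun do rewrite vec3E.
    by apply: is_derive_eq (is_deriveD (is_derive_cst y z 1) drx) _; rewrite add0r.
  + by apply: (dl _ _ 0) => t; rewrite vec3E addr0.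
  + by move: (partial 0 h _) (partial 1 h _) (partial 2 h _) => a0 a1 a2; ring.
Qed.

(** Pointwise algebra: [w] stands for the z-component of the field, [Dik] for the derivative of
    component k along i, and the six equations are the entries of the Lie derivative. The
    conclusions are the Killing equations in the frame where d/dz is replaced by v = d/dz - s1 d/dx
    - s2 d/dy, orthogonal to the horizontal plane. *)
Lemma killing_orthogonal_frame (R : realType)
    (m C S q1 q2 f s1 s2 f0 w D00 D01 D02 D10 D11 D12 D20 D21 D22 : R) :
  q1 = (m + C) * s1 + S * s2 ->
  q2 = S * s1 + (m - C) * s2 ->
  f = f0 + q1 * s1 + q2 * s2 ->
  let D := m ^+ 2 - C ^+ 2 - S ^+ 2 in
  D != 0 -> f0 != 0 ->
  w * (- 2 * S) + ((m + C) * D00 + S * D01 + q1 * D02)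
    + ((m + C) * D00 + S * D01 + q1 * D02) = 0 ->
  w * (2 * S) + (S * D10 + (m - C) * D11 + q2 * D12)
    + (S * D10 + (m - C) * D11 + q2 * D12) = 0 ->
  w * (2 * C) + (S * D00 + (m - C) * D01 + q2 * D02)
    + ((m + C) * D10 + S * D11 + q1 * D12) = 0 ->
  w * (- q2) + (q1 * D00 + q2 * D01 + f * D02)
    + ((m + C) * D20 + S * D21 + q1 * D22) = 0 ->
  w * q1 + (q1 * D10 + q2 * D11 + f * D12)
    + (S * D20 + (m - C) * D21 + q2 * D22) = 0 ->
  w * 0 + (q1 * D20 + q2 * D21 + f * D22) + (q1 * D20 + q2 * D21 + f * D22) = 0 ->
  let N := D22 - s1 * D02 - s2 * D12 in
  [/\ N = 0,
      D20 - s1 * D00 - s2 * D10 + (- s2 * w + s1 * N)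
        = - (f0 / D) * ((m - C) * D02 - S * D12),
      D21 - s1 * D01 - s2 * D11 + (s1 * w + s2 * N)
        = - (f0 / D) * ((m + C) * D12 - S * D02),
      (m + C) * (D00 + s1 * D02) + S * (D01 + s2 * D02 - w) = 0 &
      (m - C) * (D11 + s2 * D12) + S * (D10 + s1 * D12 + w) = 0].
Proof.
move=> q1E q2E fE D Dn0 f0n0.
set K00 := (X in X = 0 -> _) => E00; set K11 := (X in X = 0 -> _) => E11.
set K01 := (X in X = 0 -> _) => E01; set K02 := (X in X = 0 -> _) => E02.
set K12 := (X in X = 0 -> _) => E12; set K22 := (X in X = 0 -> _) => E22 N.
pose V0 := D20 - s1 * D00 - s2 * D10 + (- s2 * w + s1 * N).
pose V1 := D21 - s1 * D01 - s2 * D11 + (s1 * w + s2 * N).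
have N0 : N = 0.
  apply: (mulfI f0n0); rewrite mulr0.
  (* Half the Lie derivative evaluated on (v, v), which equals f0 N. *)
  transitivity (K22 / 2 - s1 * K02 - s2 * K12
    + s1 ^+ 2 / 2 * K00 + s2 ^+ 2 / 2 * K11 + s1 * s2 * K01).
    by rewrite /K00 /K11 /K01 /K02 /K12 /K22 /N fE q1E q2E; field.
  by rewrite E00 E11 E01 E02 E12 E22; ring.
(* [F0] and [F1] are the Lie derivative on (d/dx, v) and (d/dy, v); Cramer's rule with determinant
   [D] then solves for [V0] and [V1]. *)
have F0 : (m + C) * V0 + S * V1 + f0 * D02 = 0.
  transitivity (K02 - s1 * K00 - s2 * K01).
    by rewrite /K00 /K01 /K02 /V0 /V1 /N fE q1E q2E; ring.
  by rewrite E00 E01 E02; ring.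
have F1 : S * V0 + (m - C) * V1 + f0 * D12 = 0.
  transitivity (K12 - s2 * K11 - s1 * K01).
    by rewrite /K11 /K01 /K12 /V0 /V1 /N fE q1E q2E; ring.
  by rewrite E11 E01 E12; ring.
rewrite -/V0 -/V1; split=> //.
- transitivity (((m - C) * ((m + C) * V0 + S * V1 + f0 * D02)
    - S * (S * V0 + (m - C) * V1 + f0 * D12)) / D
    - (f0 / D) * ((m - C) * D02 - S * D12)); first by rewrite /D; field.
  by rewrite F0 F1; ring.
- transitivity (((m + C) * (S * V0 + (m - C) * V1 + f0 * D12)
    - S * ((m + C) * V0 + S * V1 + f0 * D02)) / D
    - (f0 / D) * ((m + C) * D12 - S * D02)); first by rewrite /D; field.
  by rewrite F0 F1; ring.
- by rewrite -[RHS](mulr0 2^-1) -E00 /K00 q1E; field.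
- by rewrite -[RHS](mulr0 2^-1) -E11 /K11 q2E; field.
Qed.

Lemma killing_gram (R : realType) (m n b d e f : R) (X : 'rV[R]_3 -> 'rV[R]_3)
    (p : 'rV[R]_3) :
  let g := fun p : 'rV[R]_3 => E2_gram m n b d e f (p 0 2) in
  lie_metric g X p = 0 ->
  let D i k := partial i (fun q => X q 0 k) p in
  forall i j, X p 0 2 * E2_gram' m n b d e f (p 0 2) i j
    + (g p 0 j * D i 0 + g p 1 j * D i 1 + g p 2 j * D i 2)
    + (g p i 0 * D j 0 + g p i 1 * D j 1 + g p i 2 * D j 2) = 0.
Proof.
move=> g /matrixP KX D i j; have := KX i j.
by rewrite mxE [RHS]mxE !big_split /= !sum3E !partial_gram /= !mulr0 !add0r.
Qed.

Lemma is_derive_add_mul (R : realType) (F A B : R -> R) (x df a b : R) :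
  is_derive x 1 F df -> is_derive x 1 A a -> is_derive x 1 B b ->
  is_derive x 1 (fun t => F t + A t * B t) (df + (a * B x + A x * b)).
Proof.
move=> dF dA dB; apply: is_derive_eq (is_deriveD dF (is_deriveM dA dB)) _.
by congr (_ + _); rewrite addrC; congr (_ + _); exact: mulrC.
Qed.

Lemma killing_parallel_eq0 (R : realType) (m n b d e f : R)
    (X : 'rV[R]_3 -> 'rV[R]_3) (p : 'rV[R]_3) :
  let g := fun p : 'rV[R]_3 => E2_gram m n b d e f (p 0 2) in
  riemannian_metric g -> n ^+ 2 + b ^+ 2 != 0 ->
  killing g X -> nabla g X p = 0 -> X p = 0.
Proof.
move=> g gR nb0 [sX KX] nX.
have [m0 D0 f00] := gram_gt0 gR.
set Dt := m ^+ 2 - n ^+ 2 - b ^+ 2 in D0 f00.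
(* [(u, v)] is the horizontal projection of d/dz at the identity, the solution of the system
   displayed in [dE] and [eE]. Rotating that system by z gives [q1E] and [q2E]. *)
pose u := ((m - n) * d - b * e) / Dt; pose v := ((m + n) * e - b * d) / Dt.
pose f0 := f - (d * u + e * v); rewrite -/u -/v -/f0 in f00.
have {}D0 : Dt != 0 by rewrite gt_eqF.
have {}f00 : f0 != 0 by rewrite gt_eqF.
have {}m0 : m != 0 by rewrite gt_eqF.
pose C z := rotx n b (z + z); pose S z := roty n b (z + z).
pose s1 z := rotx u v z; pose s2 z := roty u v z.
have dE : d = (m + n) * u + b * v by rewrite /u /v /Dt; field.
have eE : e = b * u + (m - n) * v by rewrite /u /v /Dt; field.
have sc2 (z : R) : sin z ^+ 2 = 1 - cos z ^+ 2 by have := cos2Dsin2 z; lra.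
have CS (z : R) : C z ^+ 2 + S z ^+ 2 = n ^+ 2 + b ^+ 2.
  by rewrite /C /S /rotx /roty; ring: (sc2 (z + z)).
have q1E (z : R) : rotx d e z = (m + C z) * s1 z + S z * s2 z.
  rewrite dE eE /C /S /s1 /s2 /rotx /roty cosD sinD.
  by ring: (sc2 z).
have q2E (z : R) : roty d e z = S z * s1 z + (m - C z) * s2 z.
  rewrite dE eE /C /S /s1 /s2 /rotx /roty cosD sinD.
  by ring: (sc2 z).
have fE (z : R) : f = f0 + rotx d e z * s1 z + roty d e z * s2 z.
  by rewrite /f0 /s1 /s2 /rotx /roty; ring: (sc2 z).
have DE (z : R) : m ^+ 2 - C z ^+ 2 - S z ^+ 2 = Dt by have := CS z; rewrite /Dt; lra.
pose Xc (k : 'I_3) (q : 'rV[R]_3) : R := X q 0 k.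
pose D (i k : 'I_3) (q : 'rV[R]_3) : R := partial i (Xc k) q.
have alg (q : 'rV[R]_3) : let z := q 0 2 in let N := D 2 2 q - s1 z * D 0 2 q - s2 z * D 1 2 q in
  [/\ N = 0,
      D 2 0 q - s1 z * D 0 0 q - s2 z * D 1 0 q + (- s2 z * X q 0 2 + s1 z * N)
        = - (f0 / Dt) * ((m - C z) * D 0 2 q - S z * D 1 2 q),
      D 2 1 q - s1 z * D 0 1 q - s2 z * D 1 1 q + (s1 z * X q 0 2 + s2 z * N)
        = - (f0 / Dt) * ((m + C z) * D 1 2 q - S z * D 0 2 q),
      (m + C z) * (D 0 0 q + s1 z * D 0 2 q) + S z * (D 0 1 q + s2 z * D 0 2 q - X q 0 2) = 0 &
      (m - C z) * (D 1 1 q + s2 z * D 1 2 q) + S z * (D 1 0 q + s1 z * D 1 2 q + X q 0 2) = 0].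
  move=> z.
  have K := killing_gram (KX q); rewrite -/g -/(Xc _) in K.
  have K00 := K 0 0; have K11 := K 1 1; have K01 := K 0 1.
  have K02 := K 0 2; have K12 := K 1 2; have K22 := K 2 2.
  rewrite !mat3E -/z in K00 K11 K01 K02 K12 K22.
  have := @killing_orthogonal_frame R m (C z) (S z) _ _ _ (s1 z) (s2 z) f0 (X q 0 2)
    (D 0 0 q) (D 0 1 q) (D 0 2 q) (D 1 0 q) (D 1 1 q) (D 1 2 q)
    (D 2 0 q) (D 2 1 q) (D 2 2 q) (q1E z) (q2E z) (fE z).
  rewrite !DE => frame.
  exact: (frame D0 f00 K00 K11 K01 K02 K12 K22).
pose G := shear u v.
have G2 x y z : G x y z 0 2 = z by rewrite vec3E.
have sXc k : smooth (Xc k) by exact: sX.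
have sD i k : smooth (D i k) by exact: smooth_partial.
(* In sheared coordinates the z-component is unchanged and the horizontal components become X^k +
   s_k X^z, because the new d/dz is d/dz - s1 d/dx - s2 d/dy in the old frame. *)
have rig := @killing_rigidity R (f0 / Dt) m n b
  (fun x y z => Xc 2 (G x y z))
  (fun x y z => D 0 2 (G x y z)) (fun x y z => D 1 2 (G x y z))
  (fun x y z => partial 0 (D 0 2) (G x y z)) (fun x y z => partial 0 (D 1 2) (G x y z))
  (fun x y z => partial 1 (D 0 2) (G x y z)) (fun x y z => partial 1 (D 1 2) (G x y z))
  (fun x y z => Xc 0 (G x y z) + s1 z * Xc 2 (G x y z))
  (fun x y z => D 0 0 (G x y z) + s1 z * D 0 2 (G x y z))
  (fun x y z => D 1 0 (G x y z) + s1 z * D 1 2 (G x y z))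
  (fun x y z => Xc 1 (G x y z) + s2 z * Xc 2 (G x y z))
  (fun x y z => D 0 1 (G x y z) + s2 z * D 0 2 (G x y z))
  (fun x y z => D 1 1 (G x y z) + s2 z * D 1 2 (G x y z)).
have lin (F A : R -> R) (c x df a : R) : is_derive x 1 F df -> is_derive x 1 A a ->
    is_derive x 1 (fun t => F t + c * A t) (df + c * a).
  move=> dF dA; have := is_derive_lin c 0 dF dA dA.
  rewrite (_ : (fun t => _) = fun t => F t + c * A t); last first.
    by apply/funext => t; ring.
  by move=> H; apply: is_derive_eq H _; ring.
have dGx (h : 'rV[R]_3 -> R) (x y z : R) : smooth h ->
    is_derive x 1 (fun t => h (G t y z)) (partial 0 h (G x y z)).
  by move=> sh; have [H _ _] := is_derive_shear u v x y z sh.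
have dGy (h : 'rV[R]_3 -> R) (x y z : R) : smooth h ->
    is_derive y 1 (fun t => h (G x t z)) (partial 1 h (G x y z)).
  by move=> sh; have [_ H _] := is_derive_shear u v x y z sh.
have dGz (h : 'rV[R]_3 -> R) (x y z : R) : smooth h ->
    is_derive z 1 (fun t => h (G x y t)) (partial 2 h (G x y z)
      - s1 z * partial 0 h (G x y z) - s2 z * partial 1 h (G x y z)).
  by move=> sh; have [_ _ H] := is_derive_shear u v x y z sh.
have dWz (x y z : R) : is_derive z 1 (fun t => Xc 2 (G x y t)) 0.
  apply: is_derive_eq (dGz (Xc 2) x y z (sXc 2)) _.
  by have [N0 _ _ _ _] := alg (G x y z); rewrite G2 in N0.
have dY1z (x y z : R) : is_derive z 1 (fun t => Xc 0 (G x y t) + s1 t * Xc 2 (G x y t))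
    (- (f0 / Dt) * ((m - C z) * D 0 2 (G x y z) - S z * D 1 2 (G x y z))).
  have := is_derive_add_mul (dGz (Xc 0) x y z (sXc 0)) (is_derive_rotx u v z)
    (dGz (Xc 2) x y z (sXc 2)).
  by move=> H; apply: is_derive_eq H _; have [_ V0 _ _ _] := alg (G x y z); rewrite G2 in V0.
have dY2z (x y z : R) : is_derive z 1 (fun t => Xc 1 (G x y t) + s2 t * Xc 2 (G x y t))
    (- (f0 / Dt) * ((m + C z) * D 1 2 (G x y z) - S z * D 0 2 (G x y z))).
  have := is_derive_add_mul (dGz (Xc 1) x y z (sXc 1)) (is_derive_roty u v z)
    (dGz (Xc 2) x y z (sXc 2)).
  by move=> H; apply: is_derive_eq H _; have [_ _ V1 _ _] := alg (G x y z); rewrite G2 in V1.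
have K0 x y z : (m + C z) * (D 0 0 (G x y z) + s1 z * D 0 2 (G x y z))
    + S z * (D 0 1 (G x y z) + s2 z * D 0 2 (G x y z) - Xc 2 (G x y z)) = 0.
  by have [_ _ _ K _] := alg (G x y z); rewrite G2 in K.
have K1 x y z : (m - C z) * (D 1 1 (G x y z) + s2 z * D 1 2 (G x y z))
    + S z * (D 1 0 (G x y z) + s1 z * D 1 2 (G x y z) + Xc 2 (G x y z)) = 0.
  by have [_ _ _ _ K] := alg (G x y z); rewrite G2 in K.
have k0 : f0 / Dt != 0 by rewrite mulf_neq0 ?invr_neq0.
have := rig k0 m0 nb0 (fun x y z => dGx (Xc 2) x y z (sXc 2))
  (fun x y z => dGy (Xc 2) x y z (sXc 2)) dWz
  (fun x y z => dGx (D 0 2) x y z (sD 0 2)) (fun x y z => dGx (D 1 2) x y z (sD 1 2))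
  (fun x y z => dGy (D 0 2) x y z (sD 0 2)) (fun x y z => dGy (D 1 2) x y z (sD 1 2))
  (fun x y z => lin _ _ _ _ _ _ (dGx (Xc 0) x y z (sXc 0)) (dGx (Xc 2) x y z (sXc 2)))
  (fun x y z => lin _ _ _ _ _ _ (dGy (Xc 0) x y z (sXc 0)) (dGy (Xc 2) x y z (sXc 2)))
  (fun x y z => lin _ _ _ _ _ _ (dGx (Xc 1) x y z (sXc 1)) (dGx (Xc 2) x y z (sXc 2)))
  (fun x y z => lin _ _ _ _ _ _ (dGy (Xc 1) x y z (sXc 1)) (dGy (Xc 2) x y z (sXc 2)))
  dY1z dY2z K0 K1.
(* The sheared coordinates of [p]. *)
have GP : G (p 0 0 + s2 (p 0 2)) (p 0 1 - s1 (p 0 2)) (p 0 2) = p.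
  by rewrite /G /shear addrK subrK vec3_eta.
move=> /(_ (p 0 0 + s2 (p 0 2)) (p 0 1 - s1 (p 0 2)) (p 0 2)); rewrite GP.
move=> {rig GP K0 K1 dWz dY1z dY2z dGx dGy dGz lin} [D02 D12 + + [+ +]].
rewrite D02 D12 !mulr0 !addr0 => D00 D11 D10 D01.
(* Vanishing of the covariant derivative at [p], with its index lowered. *)
have L l i : 0 = g p l 0 * D i 0 p + g p l 1 * D i 1 p + g p l 2 * D i 2 p
  + \sum_j 2^-1 * (partial i (fun q => g q j l) p + partial j (fun q => g q i l) p
          - partial l (fun q => g q i j) p) * X p 0 j.
  rewrite -(sum3E (fun k => g p l k * D i k p)) -lower_nabla // nX.
  by rewrite big1 // => k _; rewrite [X in _ * X]mxE mulr0.
(* Here the derivative of the field contributes -(m + C) W and the Christoffel term C W, so the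
   equation is - m W = 0. *)
have w0 : X p 0 2 = 0.
  have := L 0 1; rewrite sum3E !partial_gram /= !mat3E D12 D11 D10 /Xc.
  move: (X p 0 0) (X p 0 1) (X p 0 2) (rotx n b _) (roty n b _) (rotx d e _) => x0 x1 w c s q E.
  by apply: (mulfI m0); apply: oppr_inj; rewrite mulr0 oppr0 [RHS]E; field.
rewrite /Xc w0 in D10 D01; rewrite oppr0 in D10.
have [N0 V0 V1 _ _] := alg p.
rewrite D02 D12 !mulr0 !subr0 in N0 V0 V1.
rewrite N0 w0 D00 D10 !mulr0 !subr0 !addr0 in V0.
rewrite N0 w0 D01 D11 !mulr0 !subr0 !addr0 in V1.
have L0 := L 0 2; have L1 := L 1 2.
rewrite sum3E !partial_gram /= !mat3E V0 V1 N0 w0 in L0.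
rewrite sum3E !partial_gram /= !mat3E V0 V1 N0 w0 in L1.
(* All first derivatives of the field at [p] have vanished, so [L0] and [L1] reduce to half of P'
   applied to the horizontal part, a system of determinant -(C^2 + S^2) = -(n^2 + b^2). *)
have E0 : - S (p 0 2) * X p 0 0 + C (p 0 2) * X p 0 1 = 0.
  rewrite [RHS]L0 /S /C.
  move: (X p 0 0) (X p 0 1) (rotx n b _) (roty n b _) (rotx d e _) (roty d e _).
  by move=> x0 x1 c s q r; field.
have E1 : C (p 0 2) * X p 0 0 + S (p 0 2) * X p 0 1 = 0.
  rewrite [RHS]L1 /S /C.
  move: (X p 0 0) (X p 0 1) (rotx n b _) (roty n b _) (rotx d e _) (roty d e _).
  by move=> x0 x1 c s q r; field.
have cs := CS (p 0 2).
apply/rowP; apply: ord3P; rewrite [RHS]mxE //; apply: (mulfI nb0); rewrite mulr0 -cs.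
- transitivity (C (p 0 2) * (C (p 0 2) * X p 0 0 + S (p 0 2) * X p 0 1)
    - S (p 0 2) * (- S (p 0 2) * X p 0 0 + C (p 0 2) * X p 0 1)); last first.
    by rewrite E0 E1 !mulr0 subr0.
  by move: (X p 0 0) (X p 0 1) (C _) (S _) => x0 x1 c s; ring.
- transitivity (S (p 0 2) * (C (p 0 2) * X p 0 0 + S (p 0 2) * X p 0 1)
    + C (p 0 2) * (- S (p 0 2) * X p 0 0 + C (p 0 2) * X p 0 1)); last first.
    by rewrite E0 E1 !mulr0 addr0.
  by move: (X p 0 0) (X p 0 1) (C _) (S _) => x0 x1 c s; ring.
Qed.

(** * Assembling the flat and non-flat cases *)

Theorem theorem6p1 (R : realType) (g : 'rV[R]_3 -> 'M[R]_3)
  (g_metric : riemannian_metric g) (g_inv : left_invariant g)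
  (p : 'rV[R]_3) :
  index_of_symmetry g p <> 0%N <-> flat g.
Proof.
have [m [n [b [d [e [f gE]]]]]] := left_invariant_gram g_metric g_inv.
rewrite gE in g_metric *.
have round : n ^+ 2 + b ^+ 2 = 0 -> n = 0 /\ b = 0.
  by move/eqP; rewrite paddr_eq0 ?sqr_ge0 // !sqrf_eq0 => /andP[/eqP -> /eqP ->].
rewrite /index_of_symmetry set_dim_neq0; split.
- move=> [v [X [KX <- nX]] Xp0].
  have [/round[-> ->]|nb0] := eqVneq (n ^+ 2 + b ^+ 2) 0; first exact: flat_round.
  by move: Xp0; rewrite (killing_parallel_eq0 g_metric nb0 KX nX) eqxx.
- move=> /(flat_gram_round g_metric)/round[-> ->].
  exists (delta_mx 0 0); first exact: sym_space_round.
  by apply/eqP => /rowP/(_ 0)/eqP; rewrite !mxE !eqxx oner_eq0.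
Qed.
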